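(* Let $\mathbb F=\mathbb R$ or $\mathbb F=\mathbb C$. Within the space of $(6,3)$-frames for $\mathbb F^3$ there exist uncountably many pairwise inequivalent biangular tight frames. In particular, the number of inequivalent biangular $(n,m)$-frames within a given space of $(n,m)$-frames need not be finite or countable.
   Context: An $(n,m)$-frame for $\mathbb F^m$ is a family $\{f_j\}_{j=1}^n$ of $n$ unit vectors in $\mathbb F^m$ that is tight, i.e. its synthesis matrix $F=[f_1\,\cdots\,f_n]$ satisfies $FF^*=aI_m$ for some $a>0$. Its frame angle set is $\{|\langle f_j,f_{j'}\rangle| : j\neq j'\}$, and it is biangular if this set has exactly two elements. Two biangular $(n,m)$-frames are inequivalent if they have different frame angle sets. *)

(* Defs.v *)
From mathcomp Require Import all_boot all_order all_algebra.
From mathcomp Require Import complex.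
From mathcomp Require Import all_classical all_reals.

Set Implicit Arguments.
Unset Strict Implicit.
Unset Printing Implicit Defensive.

Import Order.TTheory GRing.Theory Num.Theory.

Local Open Scope ring_scope.
Local Open Scope classical_set_scope.
Local Open Scope card_scope.

(* The parameter [conj] is the conjugation of the scalar field [F], so that
   the real and complex cases share the same definitions: it is [idfun] when
   [F] is the field [R] of real numbers and [conjc] when [F] is [R[i]].       *)

Definition inner (F : numFieldType) (conj : F -> F) (m : nat)
    (u v : 'cV[F]_m) : F :=
  \sum_(i < m) u i 0 * conj (v i 0).

Definition synthesis (F : numFieldType) (n m : nat)
    (f : 'I_n -> 'cV[F]_m) : 'M[F]_(m, n) :=
  \matrix_(i < m, j < n) f j i 0.

(* When [F] is [R[i]], [0 < a] means that [a] is real and positive. *)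
Definition is_tight (F : numFieldType) (conj : F -> F) (n m : nat)
    (f : 'I_n -> 'cV[F]_m) : Prop :=
  exists2 a : F, 0 < a &
    synthesis f *m map_mx conj (synthesis f)^T = a%:M.

Definition frames (F : numFieldType) (conj : F -> F) (n m : nat) :
    set ('I_n -> 'cV[F]_m) :=
  [set f | (forall j, inner conj (f j) (f j) = 1) /\ is_tight conj f].

(* On [R[i]] the norm takes its values in [R[i]] itself, on the nonnegative
   reals. *)
Definition frame_angles (F : numFieldType) (conj : F -> F) (n m : nat)
    (f : 'I_n -> 'cV[F]_m) : set F :=
  [set t | exists j j' : 'I_n, j != j' /\ t = `|inner conj (f j) (f j')|].

Definition biangular_frames (F : numFieldType) (conj : F -> F) (n m : nat) :
    set ('I_n -> 'cV[F]_m) :=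
  [set f | frames conj f /\ frame_angles conj f #= `I_2].

Definition inequivalent (F : numFieldType) (conj : F -> F) (n m : nat)
    (f g : 'I_n -> 'cV[F]_m) : Prop :=
  frame_angles conj f <> frame_angles conj g.

(* The classes of biangular frames up to equivalence, each one represented by
   the frame angle set that its members share. *)
Definition biangular_classes (F : numFieldType) (conj : F -> F) (n m : nat) :
    set (set F) :=
  [set frame_angles conj f | f in @biangular_frames F conj n m].

Definition uncountably_many_biangular (F : numFieldType) (conj : F -> F)
    (n m : nat) : Prop :=
  exists S : set ('I_n -> 'cV[F]_m),
    [/\ S `<=` @biangular_frames F conj n m,
        (forall f g, S f -> S g -> f <> g -> inequivalent conj f g)
      & ~ countable S].

(* Main.v *)
Require Import Defs.
From mathcomp Require Import all_boot all_order all_algebra.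
From mathcomp Require Import complex ring lra.
From mathcomp Require Import all_classical all_reals.
From mathcomp Require Import measure lebesgue_measure.

Set Implicit Arguments.
Unset Strict Implicit.
Unset Printing Implicit Defensive.

Import Order.TTheory GRing.Theory Num.Theory.

Local Open Scope ring_scope.
Local Open Scope classical_set_scope.
Local Open Scope card_scope.

(** Deform the six diagonals of the icosahedron: for real x, y with
    x^2 + y^2 = 1, take the vectors (x, y, 0) and (x, -y, 0) together with
    their images under the cyclic shift of the three coordinates.  Distinct
    coordinate rows of the synthesis matrix are orthogonal, because the products
    that involve +y cancel those that involve -y, and every row has squared
    norm 2 (x^2 + y^2) = 2; so the family is a tight frame for every such x
    and y.  The two vectors of a pair have inner product x^2 - y^2, and two
    vectors from different pairs share exactly one nonzero coordinate, which
    gives the inner product x y up to sign.  The frame angle set is therefore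
    {|x^2 - y^2|, |x y|} ([frame_angles_cyclic_frame]), and the frame moves
    in a one-parameter family without acquiring a third angle.

    With x^2 = (1 + a) / 2 and y^2 = (1 - a) / 2 the two angles are a and
    sqrt (1 - a^2) / 2.  For 0 < a < 1/3 the second one is at least 1/3, so a
    is recovered as the smaller angle: distinct parameters give inequivalent
    biangular frames, and the interval of parameters is uncountable since its
    Lebesgue measure is positive ([uncountably_many_biangular63]).  All the
    vectors are real, so the same family serves over the complex numbers, via
    an embedding iota of the reals that is fixed by the conjugation. *)

(** * Cardinalities *)

Lemma card_set2_eq_II2 (T : Type) (u v : T) : u <> v -> [set u; v] #= `I_2.
Proof.
move=> uv; pose f k := if k == 0%N then u else v.
have -> : [set u; v] = f @` `I_2.
  apply/seteqP; split=> [t [] ->|_ [k _ <-]]; [by exists 0%N|by exists 1%N|].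
  by rewrite /f; case: eqP => _; [left|right].
apply: inj_card_eq => k l; rewrite !inE/= /f.
by case: k l => [|[|//]] [|[|//]] //= _ _ e; case: uv.
Qed.

Lemma uncountable_itvoo (R : realType) (a b : R) :
  a < b -> ~ countable `]a, b[%classic.
Proof.
move=> ab /countable_lebesgue_measure0.
rewrite lebesgue_measure_itv/= lte_fin ab -EFinD => -[] /eqP.
by rewrite subr_eq0 (gt_eqF ab).
Qed.

(** * The deformed icosahedron *)

(** Indices 0, 1, 2 give the cyclic shifts of (x, y, 0), indices 3, 4, 5 those
    of (x, -y, 0); so j and j + 3 form the pairs with the same support. *)
Definition cyclic_frame (F : pzRingType) (x y : F) (j : 'I_6) : 'cV[F]_3 :=
  \col_(i < 3) (if i == (j %% 3)%N :> nat then x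
                else if i == (j.+1 %% 3)%N :> nat then (-1) ^+ (2 < j)%N * y
                else 0).

Section CyclicFrame.
Variables (F : numFieldType) (conj : F -> F) (x y : F).
Hypotheses (conj0 : conj 0 = 0) (conjx : conj x = x).
Hypotheses (conjy : conj y = y) (conjNy : conj (- y) = - y).
Hypothesis xy1 : x ^+ 2 + y ^+ 2 = 1.

Let conj_cyclic_frame j i :
  conj (cyclic_frame x y j i 0) = cyclic_frame x y j i 0.
Proof.
rewrite mxE; case: ifP => // _; case: ifP => // _.
by case: (2 < j)%N; rewrite ?mulN1r ?mul1r.
Qed.

Let inner_cyclic_frameE j j' :
  inner conj (cyclic_frame x y j) (cyclic_frame x y j') =
  \sum_(i < 3) cyclic_frame x y j i 0 * cyclic_frame x y j' i 0.
Proof. by apply: eq_bigr => i _; rewrite conj_cyclic_frame. Qed.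

Lemma frames_cyclic_frame : frames conj (cyclic_frame x y).
Proof.
split=> [j|].
  rewrite inner_cyclic_frameE -xy1 !big_ord_recr big_ord0/= !mxE/=.
  by case: j => -[|[|[|[|[|[|//]]]]]] p /=; ring.
(* The constant 2 is kept in the form 2 (x^2 + y^2): the entries of the matrix
   equation are then polynomial identities in x and y. *)
exists (2 * (x ^+ 2 + y ^+ 2)); first by rewrite xy1 mulr1.
have -> : map_mx conj (synthesis (cyclic_frame x y))^T =
          (synthesis (cyclic_frame x y))^T.
  apply/matrixP => j i; have := conj_cyclic_frame j i.
  by rewrite [map_mx _ _ _ _]mxE !mxE.
apply/matrixP => i k; rewrite !mxE.
rewrite !big_ord_recr big_ord0/= !mxE/=.
by case: i k => -[|[|[|//]]] p [[|[|[|//]]] q]; rewrite /= ?mulr1n ?mulr0n; ring.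
Qed.

Lemma frame_angles_cyclic_frame :
  frame_angles conj (cyclic_frame x y) =
  [set `|x ^+ 2 - y ^+ 2|; `|x * y| ].
Proof.
apply/seteqP; split=> [_ [j [j' [jj' ->]]]|t /=].
  suff: [\/ inner conj (cyclic_frame x y j) (cyclic_frame x y j') =
             x ^+ 2 - y ^+ 2,
            inner conj (cyclic_frame x y j) (cyclic_frame x y j') = x * y
          | inner conj (cyclic_frame x y j) (cyclic_frame x y j') = - (x * y)].
    by case=> ->; rewrite /= ?normrN; [left|right|right].
  rewrite inner_cyclic_frameE !big_ord_recr big_ord0/= !mxE/=.
  case: j j' jj' => -[|[|[|[|[|[|//]]]]]] p [[|[|[|[|[|[|//]]]]]] q] //= _;
  by first [constructor 1; ring | constructor 2; ring | constructor 3; ring].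
have anglesP (j j' : 'I_6) : j != j' ->
    frame_angles conj (cyclic_frame x y)
      `|\sum_(i < 3) cyclic_frame x y j i 0 * cyclic_frame x y j' i 0|.
  by move=> jj'; exists j, j'; rewrite inner_cyclic_frameE.
(* Indices 0 and 3 share their support; indices 0 and 1 overlap only at the
   coordinate 1, where the entries are y and x. *)
case=> ->.
- have := @anglesP 0 3%:R isT; rewrite !big_ord_recr big_ord0/= !mxE/=.
  by congr (frame_angles _ _ `|_|); ring.
- have := @anglesP 0 1 isT; rewrite !big_ord_recr big_ord0/= !mxE/=.
  by congr (frame_angles _ _ `|_|); ring.
Qed.

End CyclicFrame.

(** * Parametrization by the smaller angle *)

Section AngleFamily.
Variables (R : realType) (F : numFieldType) (conj : F -> F).
Variable iota : {rmorphism R -> F}.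
Hypothesis conj_iota : forall r, conj (iota r) = iota r.
Hypothesis norm_iota : forall r, `|iota r| = iota `|r|.

Let fx (a : R) : F := iota (Num.sqrt ((1 + a) / 2)).
Let fy (a : R) : F := iota (Num.sqrt ((1 - a) / 2)).
Let frame a := cyclic_frame (fx a) (fy a).
Let angle2 (a : R) : R := Num.sqrt ((1 + a) / 2) * Num.sqrt ((1 - a) / 2).

Let conj_fx a : conj (fx a) = fx a. Proof. exact: conj_iota. Qed.
Let conj_fy a : conj (fy a) = fy a. Proof. exact: conj_iota. Qed.
Let conj_Nfy a : conj (- fy a) = - fy a.
Proof. by rewrite /fy -rmorphN conj_iota. Qed.
Let conj0 : conj 0 = 0. Proof. by rewrite -(rmorph0 iota) conj_iota. Qed.

Let fx_sqr a : 0 < a < 1 / 3 -> fx a ^+ 2 = iota ((1 + a) / 2).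
Proof. by move=> ?; rewrite /fx -rmorphXn/= sqr_sqrtr//; lra. Qed.

Let fy_sqr a : 0 < a < 1 / 3 -> fy a ^+ 2 = iota ((1 - a) / 2).
Proof. by move=> ?; rewrite /fy -rmorphXn/= sqr_sqrtr//; lra. Qed.

(** The square of the second angle is (1 - a^2) / 4, at least 2/9 > 1/9. *)
Let angle2_ge a : 0 < a < 1 / 3 -> 1 / 3 <= angle2 a.
Proof.
move=> a3; have ge0 : 0 <= angle2 a by rewrite mulr_ge0 ?sqrtr_ge0.
have : (1 / 3) ^+ 2 <= angle2 a ^+ 2.
  by rewrite [leRHS]exprMn !sqr_sqrtr; [nra|lra|lra].
by rewrite ler_pXn2r// nnegrE; lra.
Qed.

Let frame_anglesE a : 0 < a < 1 / 3 ->
  frame_angles conj (frame a) = [set iota a; iota (angle2 a)].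
Proof.
move=> a3; rewrite frame_angles_cyclic_frame// fx_sqr// fy_sqr//.
rewrite -rmorphB -rmorphM !norm_iota -/(angle2 a).
have -> : (1 + a) / 2 - (1 - a) / 2 = a by lra.
by rewrite !ger0_norm//; have := angle2_ge a3; lra.
Qed.

Let frame_biangular a : 0 < a < 1 / 3 -> biangular_frames conj (frame a).
Proof.
move=> a3; split.
  apply: frames_cyclic_frame => //.
  by rewrite fx_sqr// fy_sqr// -rmorphD -(rmorph1 iota); congr (iota _); lra.
rewrite frame_anglesE//; apply: card_set2_eq_II2 => /fmorph_inj e.
by have := angle2_ge a3; rewrite -e; lra.
Qed.

(** If a is an angle of the frame of parameter b, then it is b, since the
    other angle of that frame is out of the range of a. *)
Let frame_angles_inj a b : 0 < a < 1 / 3 -> 0 < b < 1 / 3 ->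
  frame_angles conj (frame a) = frame_angles conj (frame b) -> a = b.
Proof.
move=> a3 b3; rewrite !frame_anglesE// => /seteqP[/(_ (iota a))+ _].
case; [by left|exact: fmorph_inj|move=> /fmorph_inj e].
by have := angle2_ge b3; rewrite -e; lra.
Qed.

Lemma uncountably_many_biangular63 : uncountably_many_biangular conj 6 3.
Proof.
have itvP a : `]0, 1 / 3[%classic a -> 0 < a < 1 / 3 by rewrite /= in_itv.
exists (frame @` `]0, 1 / 3[%classic); split.
- by move=> _ [a /itvP a3 <-]; exact: frame_biangular.
- move=> _ _ [a /itvP a3 <-] [b /itvP b3 <-] ab /(frame_angles_inj a3 b3) e.
  by rewrite e in ab.
- have inj : {in `]0, 1 / 3[%classic &, injective frame}.
    move=> a b; rewrite !inE => /itvP a3 /itvP b3 e.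
    by apply: frame_angles_inj => //; rewrite e.
  rewrite /countable (card_le_eql (inj_card_eq inj)).
  by apply: uncountable_itvoo; lra.
Qed.

End AngleFamily.

(** On pairwise inequivalent frames the frame angle set is an injective
    invariant, so an uncountable family of them has uncountably many angle sets. *)
Lemma uncountable_biangular_classes (F : numFieldType) (conj : F -> F)
    (n m : nat) : uncountably_many_biangular conj n m ->
  ~ finite_set (biangular_classes conj n m) /\
  ~ countable (biangular_classes conj n m).
Proof.
move=> [S [SB Sinj Snc]].
suff nc : ~ countable (biangular_classes conj n m).
  by split=> // /finite_set_countable.
move=> cB; apply: Snc.
have inj : {in S &, injective (@frame_angles F conj n m)}.
  move=> f g; rewrite !inE => Sf Sg; apply: contraPP => fg.
  exact: Sinj.
rewrite /countable -(card_le_eql (inj_card_eq inj)).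
apply: sub_countable cB; apply: subset_card_le.
exact: image_subset.
Qed.

Lemma uncountably_many_biangular63_real (R : realType) :
  uncountably_many_biangular (@idfun R) 6 3.
Proof. exact: (@uncountably_many_biangular63 R R idfun idfun). Qed.

Lemma uncountably_many_biangular63_complex (R : realType) :
  uncountably_many_biangular (@conjc R) 6 3.
Proof.
apply: (@uncountably_many_biangular63 R _ _ (real_complex R)) => r.
  exact: conjc_real.
by rewrite normc_def /= expr0n /= addr0 sqrtr_sqr.
Qed.

Theorem mainTheorem6 (R : realType) :
  (uncountably_many_biangular (@idfun R) 6 3 /\
   uncountably_many_biangular (@conjc R) 6 3) /\
  ((exists n m : nat,
      ~ finite_set (biangular_classes (@idfun R) n m) /\
      ~ countable (biangular_classes (@idfun R) n m)) /\
   (exists n m : nat,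
      ~ finite_set (biangular_classes (@conjc R) n m) /\
      ~ countable (biangular_classes (@conjc R) n m))).
Proof.
have real63 := uncountably_many_biangular63_real R.
have complex63 := uncountably_many_biangular63_complex R.
by split=> //; split; exists 6%N, 3%N; exact: uncountable_biangular_classes.
Qed.
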